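(* Let $R$ be a Noetherian local ring with infinite residue field. Assume $I$ is an ideal of $R$ with $\ell(I)=\mu(I)-1$, and let $J$ be a minimal reduction of $I$. If $h_1,\ldots,h_s$ is a minimal generating set of $I$, then $J$ has a generating set of the form $$(h_1+a_1h_t,\; h_2+a_2h_t,\;\ldots,\; h_s+a_sh_t)$$ for some $1\le t\le s$, where $a_i\in R$ for all $i$ and $a_t=-1$.
   Context: $\mu(I)$ denotes the minimal number of generators of $I$. A reduction of $I$ is an ideal $J\subset I$ with $I^{r+1}=JI^r$ for some integer $r\ge 0$; a minimal reduction is a reduction that is minimal with respect to inclusion. The analytic spread is $\ell(I)=\dim \mathcal{F}(I)$, where $\mathcal{F}(I)=\bigoplus_{i\ge 0} I^i/\mathfrak{m}I^i$ is the special fiber ring and $\mathfrak{m}$ is the maximal ideal of $R$. *)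

(* Defs.v *)
From HB Require Import structures.
From mathcomp Require Import all_boot all_order all_algebra.
From mathcomp Require Import boolp classical_sets cardinality.

Set Implicit Arguments.
Unset Strict Implicit.
Unset Printing Implicit Defensive.

Import GRing.Theory.
Local Open Scope ring_scope.
Local Open Scope classical_set_scope.

(* Lets an ideal be applied to an element, as sets are. *)
Identity Coercion set_to_fun : set >-> Funclass.

Section Ideals.
Variable A : comNzRingType.

Definition is_ideal (I : set A) : Prop :=
  [/\ I 0, forall x y, I x -> I y -> I (x + y) & forall a x, I x -> I (a * x)].

(* Unlike ring_quotient's idealr, this includes the unit ideal. *)
Record ideal : Type :=
  Ideal { ideal_set :> set A; ideal_closed : is_ideal ideal_set }.

Implicit Types I J M P : ideal.

Lemma ideal0 I : I 0. Proof. by case: (ideal_closed I). Qed.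
Lemma idealD I x y : I x -> I y -> I (x + y).
Proof. by case: (ideal_closed I) => _ + _; apply. Qed.
Lemma idealM I a x : I x -> I (a * x).
Proof. by case: (ideal_closed I) => _ _; apply. Qed.
Lemma idealB I x y : I x -> I y -> I (x - y).
Proof. by move=> Ix Iy; rewrite -mulN1r; apply: idealD => //; apply: idealM. Qed.
Lemma ideal_sum I (T : Type) (r : seq T) (Q : pred T) (F : T -> A) :
  (forall i, Q i -> I (F i)) -> I (\sum_(i <- r | Q i) F i).
Proof. by move=> FI; elim/big_ind: _ => //; [apply: ideal0|apply: idealD]. Qed.

Lemma smallest_is_ideal (X : set A) : is_ideal (smallest is_ideal X).
Proof.
split; first by move=> I [[]].
- move=> x y Ix Iy I [Iid XI].
  have [_ addI _] := Iid.
  by apply: addI; [apply: Ix | apply: Iy].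
move=> a x Ix I [Iid XI].
have [_ _ mulI] := Iid.
by apply: mulI; apply: Ix.
Qed.

Definition ideal_gen (X : set A) : ideal := Ideal (smallest_is_ideal X).

Lemma ideal_gen_sub (X : set A) I : X `<=` I -> ideal_gen X `<=` I.
Proof. by apply: smallest_sub; apply: ideal_closed. Qed.

Lemma sub_ideal_gen (X : set A) : X `<=` ideal_gen X.
Proof. exact: sub_gen_smallest. Qed.

Definition ideal_mul I J : ideal := ideal_gen [set x * y | x in I & y in J].

Lemma mem_ideal_mul I J x y : I x -> J y -> ideal_mul I J (x * y).
Proof. by move=> Ix Jy; apply: sub_ideal_gen; exists x => //; exists y. Qed.

Lemma is_idealT : is_ideal setT. Proof. by []. Qed.

Fixpoint ideal_exp I (n : nat) : ideal :=
  if n is k.+1 then ideal_mul I (ideal_exp I k) else Ideal is_idealT.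

Lemma ideal_mulP I J (K : ideal) z :
  (forall x y, I x -> J y -> K (z * (x * y))) ->
  forall u, ideal_mul I J u -> K (z * u).
Proof.
move=> H u Hu.
have idL : is_ideal [set v | K (z * v)].
  split=> /=; first by rewrite mulr0; apply: ideal0.
    by move=> x y Kx Ky; rewrite mulrDr; apply: idealD.
  by move=> a x Kx; rewrite mulrCA; apply: idealM.
apply: (@ideal_gen_sub _ (Ideal idL) _ _ Hu) => _ [x Ix [y Jy <-]] /=.
exact: H.
Qed.

Lemma ideal_expD I i j x y :
  ideal_exp I i x -> ideal_exp I j y -> ideal_exp I (i + j)%N (x * y).
Proof.
elim: i x => [|i IHi] x Ix Iy; first exact: idealM.
rewrite addSn mulrC; apply: (ideal_mulP _ Ix) => a b Ia Ib /=.
by rewrite mulrCA [y * b]mulrC; apply: mem_ideal_mul => //; apply: IHi.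
Qed.

Lemma ideal_mul_expD M I i j x y :
  ideal_exp I i x -> ideal_mul M (ideal_exp I j) y ->
  ideal_mul M (ideal_exp I (i + j)%N) (x * y).
Proof.
move=> Ix; apply: ideal_mulP => a b Ma Ib.
by rewrite mulrCA; apply: mem_ideal_mul => //; apply: ideal_expD.
Qed.

Definition prime_ideal P : Prop :=
  ~ P 1 /\ forall x y, P (x * y) -> P x \/ P y.

Definition maximal_ideal M : Prop :=
  ~ M 1 /\ forall J, ~ J 1 -> M `<=` J -> J = M :> set A.

Definition noetherian : Prop :=
  forall I, exists s : seq A, I = ideal_gen [set` s] :> set A.

Definition local_ring M : Prop :=
  maximal_ideal M /\ forall J, maximal_ideal J -> J = M :> set A.

Lemma local_ring_proper M : local_ring M -> ~ M 1.
Proof. by case=> -[]. Qed.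

Definition prime_chain (d : nat) (P : nat -> ideal) : Prop :=
  (forall i, (i <= d)%N -> prime_ideal (P i)) /\
  (forall i, (i < d)%N -> P i `<` P i.+1).

(* The supremum of the lengths of prime chains of A is the natural number d. *)
Definition krull_dim_eq (d : nat) : Prop :=
  (exists P : nat -> ideal, prime_chain d P) /\
  (forall e (P : nat -> ideal), prime_chain e P -> (e <= d)%N).

Definition generates (n : nat) (g : 'I_n -> A) I : Prop :=
  ideal_gen (range g) = I :> set A.

Definition mu_eq I (n : nat) : Prop :=
  (exists g : 'I_n -> A, generates g I) /\
  (forall k (g : 'I_k -> A), generates g I -> (n <= k)%N).

(* Minimality is irredundancy: no proper subfamily generates I. *)
Definition minimal_generating_set (n : nat) (g : 'I_n -> A) I : Prop :=
  generates g I /\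
  forall D : set 'I_n, ideal_gen (g @` D) = I :> set A -> D = setT.

Definition reduction I J : Prop :=
  J `<=` I /\
  exists r : nat, ideal_exp I r.+1 = ideal_mul J (ideal_exp I r) :> set A.

Definition minimal_reduction I J : Prop :=
  reduction I J /\
  forall K, reduction I K -> K `<=` J -> K = J :> set A.

End Ideals.

Section QuotientRing.
Variables (A : comNzRingType) (I : ideal A) (I1 : ~ I 1).

Definition ideal_pred (_ : ~ I 1) : {pred A} := fun x => `[< I x >].

Lemma ideal_pred_closed : idealr_closed (ideal_pred I1).
Proof.
split; first by apply/asboolP; apply: (ideal0 I).
  by apply/negP => /asboolP.
move=> a x y /asboolP Ix /asboolP Iy; apply/asboolP.
by apply: idealD => //; apply: idealM.
Qed.

HB.instance Definition _ :=
  isIdealr.Build A (ideal_pred I1) ideal_pred_closed.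

Definition quotient_ring : comNzRingType := {ideal_quot (ideal_pred I1)}.

Definition infinite_quotient : Prop := infinite_set [set: quotient_ring].

End QuotientRing.

(* The Rees algebra: polynomials whose coefficient of 'X^i lies in I^i. *)
Section Rees.
Variables (R : comNzRingType) (I : ideal R).

Definition rees_pred : {pred {poly R}} :=
  fun p => `[< forall i, ideal_exp I i p`_i >].

Lemma rees_closed : subring_closed rees_pred.
Proof.
split.
- by apply/asboolP => -[|i]; rewrite coef1 //; apply: (ideal0 (ideal_exp I i.+1)).
- move=> p q /asboolP Ip /asboolP Iq; apply/asboolP => i.
  by rewrite coefB; apply: idealB.
move=> p q /asboolP Ip /asboolP Iq; apply/asboolP => i.
rewrite coefM; apply: ideal_sum => j _.
have {1}-> : i = (j + (i - j))%N by rewrite subnKC // -ltnS.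
exact: ideal_expD.
Qed.

HB.instance Definition _ :=
  GRing.isSubringClosed.Build {poly R} rees_pred rees_closed.

Record rees : Type := Rees { rees_poly :> {poly R}; _ : rees_poly \in rees_pred }.

HB.instance Definition _ := [isSub for rees_poly].
HB.instance Definition _ := [Choice of rees by <:].
HB.instance Definition _ := [SubChoice_isSubComNzRing of rees by <:].

End Rees.

(* The special fiber ring, as the quotient of (+)_i I^i by (+)_i m I^i, whose *)
(* degree i component is I^i / m I^i.                                         *)
Section SpecialFiber.
Variables (R : comNzRingType) (m I : ideal R) (m1 : ~ m 1).

Definition fiber_kernel_set : set (rees I) :=
  [set p | forall i, ideal_mul m (ideal_exp I i) (rees_poly p)`_i].

Lemma fiber_kernel_is_ideal : is_ideal fiber_kernel_set.
Proof.
split=> /=.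
- by move=> i; rewrite coef0; apply: (ideal0 (ideal_mul m (ideal_exp I i))).
- by move=> p q Kp Kq i; rewrite coefD; apply: idealD.
move=> a p Kp i; rewrite coefM; apply: ideal_sum => j _.
have {1}-> : i = (j + (i - j))%N by rewrite subnKC // -ltnS.
apply: ideal_mul_expD => //.
by move: (valP a) => /asboolP; apply.
Qed.

Definition fiber_kernel : ideal (rees I) := Ideal fiber_kernel_is_ideal.

Lemma fiber_kernel_proper : ~ fiber_kernel 1.
Proof.
move=> /(_ 0%N); rewrite coef1 /= => H; apply: m1.
apply: (ideal_gen_sub _ H) => _ [x mx [y _ <-]].
by rewrite mulrC; apply: idealM.
Qed.

Definition special_fiber : comNzRingType := quotient_ring fiber_kernel_proper.

Definition analytic_spread_eq (l : nat) : Prop := krull_dim_eq special_fiber l.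

End SpecialFiber.

(* Main.v *)
(** Let [F] be the special fiber ring of [I] and [k] the residue field.  Two facts
    about [F] carry the proof.

    If a reduction [K] of [I] has [d] generators, then prime chains of [F] have length
    at most [d]: picking [x_i] in [P_(i+1)] but not in [P_i] along a chain of length
    [d + 1], the degree [<= N] part of [F] has dimension [O(N^d)], so the monomials in
    [x_0, ..., x_d] are linearly dependent over [k], whereas a prime chain forces such
    [x_i] to be algebraically independent (the lowest term of a relation, in the
    lexicographic order, must vanish).

    If the [s] generators [h_i] of [I] are algebraically independent in [F], then [F] is a
    polynomial ring and has a prime chain of length [s].  Otherwise a form [f] over [k]
    vanishes on them; as [k] is infinite, [f b <> 0] for some [b] with [b_t = 1], and
    then the elements [h_i - b_i h_t] generate a reduction, since [h_t^deg(f)] can be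
    eliminated.  So [I] itself is not a minimal reduction when [l(I) < mu(I)].

    Choose now a minimal set [T] of indices such that the [h_t], [t] in [T], generate [I]
    modulo [J].  Subtracting from the other [h_i] a combination of these gives [s - #|T|]
    elements of [J] that generate [J] modulo [m I], hence generate a reduction, hence
    [J].  The first fact gives [#|T| <= 1] and the second one [#|T| <> 0]. *)

Require Import Defs.
From HB Require Import structures.
From mathcomp Require Import all_boot all_order all_algebra.
From mathcomp Require Import mpoly.
From mathcomp Require Import boolp classical_sets cardinality.

Set Implicit Arguments.
Unset Strict Implicit.
Unset Printing Implicit Defensive.

Import GRing.Theory.
Local Open Scope ring_scope.
Local Open Scope classical_set_scope.

(** * Finite generation, sums and products of ideals *)

Section IdealArithmetic.
Variable A : comNzRingType.
Implicit Types (I J K L : ideal A) (X Y : set A).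

Lemma idealMr I x a : I x -> I (x * a).
Proof. by rewrite mulrC; apply: idealM. Qed.

Lemma ideal_gen_mono X Y : X `<=` Y -> ideal_gen X `<=` ideal_gen Y.
Proof. by move=> XY; apply: ideal_gen_sub => x /XY; apply: sub_ideal_gen. Qed.

Lemma ideal_gen_imageP (T : finType) (Q : pred T) (g : T -> A) x :
  ideal_gen (g @` [set i | Q i]) x <-> exists c : T -> A, x = \sum_(i | Q i) c i * g i.
Proof.
split=> [|[c ->]]; last first.
  by apply: ideal_sum => i Qi; apply: idealM; apply: sub_ideal_gen; exists i.
have idS : is_ideal [set x | exists c : T -> A, x = \sum_(i | Q i) c i * g i].
  split=> /=.
  - by exists (fun=> 0); rewrite big1 // => i _; rewrite mul0r.
  - move=> _ _ [c ->] [d ->]; exists (fun i => c i + d i).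
    by rewrite -big_split; apply: eq_bigr => i _; rewrite mulrDl.
  - move=> a _ [c ->]; exists (fun i => a * c i).
    by rewrite mulr_sumr; apply: eq_bigr => i _; rewrite mulrA.
apply: (@ideal_gen_sub _ _ (Ideal idS)) => _ [i Qi <-] /=.
exists (fun j => (j == i)%:R); rewrite (bigD1 i) //= eqxx mul1r big1 ?addr0 //.
by move=> j /andP[_ /negPf ->]; rewrite mul0r.
Qed.

Lemma ideal_genP (T : finType) (g : T -> A) x :
  ideal_gen (range g) x <-> exists c : T -> A, x = \sum_i c i * g i.
Proof.
rewrite -(ideal_gen_imageP predT g x) (_ : [set i | predT i] = setT) //.
by apply/seteqP; split.
Qed.

Lemma ideal_gen_seqP (s : seq A) x :
  ideal_gen [set` s] x <-> exists c : 'I_(size s) -> A, x = \sum_i c i * s`_i.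
Proof.
have -> : [set` s] = range (fun i : 'I_(size s) => s`_i).
  apply/seteqP; split=> [y /= ys|_ [i _ <-]] /=; last exact: mem_nth.
  exists (Ordinal (etrans (index_mem y s) ys)) => //=.
  exact: nth_index.
exact: ideal_genP.
Qed.

Definition ideal_add_set I J : set A := [set z | exists x y, [/\ I x, J y & z = x + y]].

Lemma ideal_add_closed I J : is_ideal (ideal_add_set I J).
Proof.
split.
- by exists 0, 0; rewrite addr0; split=> //; apply: ideal0.
- move=> _ _ [x [y [Ix Jy ->]]] [x' [y' [Ix' Jy' ->]]].
  by exists (x + x'), (y + y'); rewrite addrACA; split=> //; apply: idealD.
- move=> a _ [x [y [Ix Jy ->]]]; exists (a * x), (a * y).
  by rewrite mulrDr; split=> //; apply: idealM.
Qed.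

Definition ideal_add I J : ideal A := Ideal (ideal_add_closed I J).

Lemma ideal_addl I J : I `<=` ideal_add I J.
Proof. by move=> x Ix; exists x, 0; rewrite addr0; split=> //; apply: ideal0. Qed.

Lemma ideal_addr I J : J `<=` ideal_add I J.
Proof. by move=> x Jx; exists 0, x; rewrite add0r; split=> //; apply: ideal0. Qed.

Lemma ideal_mul_sub I J K :
  (forall x y, I x -> J y -> K (x * y)) -> ideal_mul I J `<=` K.
Proof. by move=> IJK; apply: ideal_gen_sub => _ [x Ix [y Jy <-]]; apply: IJK. Qed.

Lemma ideal_mulS I I' J J' :
  I `<=` I' -> J `<=` J' -> ideal_mul I J `<=` ideal_mul I' J'.
Proof.
by move=> sI sJ; apply: ideal_mul_sub => x y /sI ? /sJ ?; apply: mem_ideal_mul.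
Qed.

Lemma ideal_mul_subl I J : ideal_mul I J `<=` I.
Proof. by apply: ideal_mul_sub => x y Ix _; apply: idealMr. Qed.

Lemma ideal_exp1 I x : I x -> ideal_exp I 1 x.
Proof. by move=> Ix; rewrite -[x]mulr1; apply: mem_ideal_mul. Qed.

Lemma ideal_exp_prod I (T : Type) (r : seq T) (e : T -> nat) (F : T -> A) :
  (forall i, ideal_exp I (e i) (F i)) ->
  ideal_exp I (\sum_(i <- r) e i)%N (\prod_(i <- r) F i).
Proof.
move=> FI; elim: r => [|i r IH]; first by rewrite !big_nil.
by rewrite !big_cons; apply: ideal_expD.
Qed.

Lemma ideal_exp_pow I x k : I x -> ideal_exp I k (x ^+ k).
Proof.
by move=> Ix; elim: k => // k IH; rewrite exprS; apply: mem_ideal_mul.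
Qed.

(** Multiplying the equation for [r] by powers of [I] gives it in every higher degree, so a factor
    in [J] can be split off repeatedly until degree [r] is reached. *)
Lemma reduction_exp I J r :
    J `<=` I -> ideal_exp I r.+1 = ideal_mul J (ideal_exp I r) :> set A ->
  forall i, (r <= i)%N -> ideal_exp I i.+1 = ideal_mul J (ideal_exp I i) :> set A.
Proof.
move=> JI redJ; elim=> [|i IH]; first by rewrite leqn0 => /eqP r0; rewrite -r0 in redJ *.
rewrite leq_eqVlt => /orP[/eqP <- //|]; rewrite ltnS => ri.
apply/seteqP; split; last exact: ideal_mulS.
rewrite [in X in ideal_exp I X]/=.
apply: ideal_mul_sub => x y Ix.
have -> : ideal_exp I i.+1 y = ideal_mul J (ideal_exp I i) y by rewrite IH.
move: y; apply: ideal_mulP => u v Ju Iv.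
by rewrite mulrCA; apply: mem_ideal_mul => //; apply: mem_ideal_mul.
Qed.

End IdealArithmetic.

(** * The projection onto a quotient ring *)

Section QuotientProjection.
Variables (A : comNzRingType) (I : ideal A) (I1 : ~ I 1).

Definition quot_proj (x : A) : quotient_ring I1 :=
  (\pi_({ideal_quot (ideal_pred I1)}) x)%qT.

Lemma quot_proj_is_additive : additive quot_proj.
Proof. by move=> x y; rewrite /quot_proj !piE. Qed.

Lemma quot_proj_is_multiplicative : multiplicative quot_proj.
Proof. by split=> [x y|]; rewrite /quot_proj !piE. Qed.

HB.instance Definition _ :=
  GRing.isAdditive.Build A (quotient_ring I1) quot_proj quot_proj_is_additive.
HB.instance Definition _ :=
  GRing.isMultiplicative.Build A (quotient_ring I1) quot_proj
    quot_proj_is_multiplicative.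

Lemma quot_proj_eq0 x : quot_proj x = 0 <-> I x.
Proof.
have -> : (quot_proj x = 0) = (quot_proj x = quot_proj 0) by rewrite rmorph0.
have := Quotient.idealrBE (ideal_pred I1) x 0; rewrite subr0 => e.
split=> [/eqP|Ix]; last apply/eqP.
  by rewrite -e => /asboolP.
by rewrite -e; apply/asboolP.
Qed.

Lemma quot_proj_surj y : exists x, quot_proj x = y.
Proof. by exists (repr y); apply: reprK. Qed.

End QuotientProjection.

(** * Local rings and Nakayama's lemma *)

Section LocalRing.
Variables (R : comNzRingType) (m : ideal R).

Lemma exists_maximal_ideal (I : ideal R) :
  ~ I 1 -> exists2 M, maximal_ideal M & I `<=` M.
Proof.
move=> I1.
pose P : set (set R) :=
  [set X | X = set0 \/ [/\ is_ideal X, I `<=` X & ~ X 1]].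
have [F FP totF|X [PX maxX]] := @Zorn_bigcup R P.
  have [F0|/existsNP[X0 /not_implyP[FX0 X0n]]] := pselect (forall X, F X -> X = set0).
    by left; apply/seteqP; split=> // x [X /F0 ->].
  right.
  have FP' X x : F X -> X x -> [/\ is_ideal X, I `<=` X & ~ X 1].
    by move=> FX Xx; case: (FP X FX) => // XE; rewrite XE in Xx.
  have [X0id IX0 _] : [/\ is_ideal X0, I `<=` X0 & ~ X0 1] by case: (FP X0 FX0).
  split.
  - split.
    + by exists X0 => //; case: X0id.
    + move=> x y [X FX Xx] [Y FY Yy].
      have [XY|YX] := totF X Y FX FY.
        exists Y => //; have [[_ addY _] _ _] := FP' Y y FY Yy.
        by apply: addY => //; apply: XY.
      exists X => //; have [[_ addX _] _ _] := FP' X x FX Xx.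
      by apply: addX => //; apply: YX.
    + move=> a x [X FX Xx]; exists X => //.
      by have [[_ _ mulX] _ _] := FP' X x FX Xx; apply: mulX.
  - by move=> x Ix; exists X0 => //; apply: IX0.
  - by move=> [X FX X1]; have [_ _] := FP' X 1 FX X1.
case: PX => [X0|[Xid IX X1]].
  exfalso; apply: (maxX I); last by right; split=> //; apply: ideal_closed.
  by rewrite X0; split=> // /(_ 0 (ideal0 I)).
exists (Ideal Xid) => //; split=> // J J1 XJ.
apply/seteqP; split=> // x Jx; apply: contrapT => Xx.
apply: (maxX J); first by split=> // /(_ _ Jx).
by right; split=> //; [apply: ideal_closed | move=> y /IX; apply: XJ].
Qed.

Hypothesis localR : local_ring m.

(** If [c] generated a proper ideal, a maximal ideal would contain it, and the only one is [m]. *)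
Lemma local_inv c : ~ m c -> exists b, b * c = 1.
Proof.
move=> mc; apply: contrapT => cN1.
have [/(ideal_genP (fun _ : 'I_1 => c))[b /esym] |M maxM cM] :=
  @exists_maximal_ideal (ideal_gen (range (fun _ : 'I_1 => c))) _.
  by rewrite big_ord1 => bc; apply: cN1; exists (b 0).
apply: mc; rewrite -((proj2 localR) M maxM); apply: cM.
by apply: sub_ideal_gen; exists 0.
Qed.

Lemma local_prime a b : m (a * b) -> m a \/ m b.
Proof.
move=> mab; have [|/local_inv[c ca]] := pselect (m a); [by left | right].
by rewrite -[b]mul1r -ca -mulrA; apply: idealM.
Qed.

Lemma local_1B a : m a -> exists b, b * (1 - a) = 1.
Proof.
move=> ma; apply: local_inv => m1a; apply: (local_ring_proper localR).
by rewrite -(subrK a 1); apply: idealD.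
Qed.

(* Multiplying (1 - A) s = b, with A over m and b over L, by the adjugate. *)
Lemma nakayama (N L : ideal R) (s : seq R) :
  N = ideal_gen [set` s] :> set R -> N `<=` ideal_add L (ideal_mul m N) -> N `<=` L.
Proof.
move=> Ns NL.
have mNP x : ideal_mul m N x ->
    exists2 c : 'I_(size s) -> R, (forall i, m (c i)) & x = \sum_i c i * s`_i.
  have idS : is_ideal [set x | exists2 c : 'I_(size s) -> R,
      (forall i, m (c i)) & x = \sum_i c i * s`_i].
    split=> /=.
    - exists (fun=> 0); first by move=> _; apply: ideal0.
      by rewrite big1 // => i _; rewrite mul0r.
    - move=> _ _ [c mc ->] [d md ->]; exists (fun i => c i + d i).
        by move=> i; apply: idealD.
      by rewrite -big_split; apply: eq_bigr => i _; rewrite mulrDl.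
    - move=> a _ [c mc ->]; exists (fun i => a * c i).
        by move=> i; apply: idealM.
      by rewrite mulr_sumr; apply: eq_bigr => i _; rewrite mulrA.
  move: x; apply: (@ideal_mul_sub _ _ _ (Ideal idS)) => x y mx.
  rewrite Ns => /ideal_gen_seqP[c ->] /=; exists (fun i => x * c i).
    by move=> i; apply: idealMr.
  by rewrite mulr_sumr; apply: eq_bigr => i _; rewrite mulrA.
have /choice[c /choice[d cdP]] (i : 'I_(size s)) :
    exists c, exists d : 'I_(size s) -> R, [/\ L c, forall j, m (d j) &
      s`_i = c + \sum_j d j * s`_j].
  have [|x [y [Lx /mNP[d md ->] sE]]] := NL s`_i.
    by rewrite Ns; apply: sub_ideal_gen => /=; apply: mem_nth.
  by exists x, d.
pose D := \matrix_(i, j) d i j; pose S := \col_(i < size s) s`_i.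
pose C := \col_(i < size s) c i.
have DS : (1%:M - D) *m S = C.
  apply/matrixP => i j; rewrite mulmxBl mul1mx !mxE.
  have [_ _ {1}->] := cdP i; apply/eqP; rewrite subr_eq; apply/eqP; congr (_ + _).
  by apply: eq_bigr => k _; rewrite !mxE.
have Ldet (i : 'I_(size s)) : L (\det (1%:M - D) * s`_i).
  have /matrixP/(_ i 0) : \adj (1%:M - D) *m (1%:M - D) *m S = \adj (1%:M - D) *m C.
    by rewrite -mulmxA DS.
  rewrite mul_adj_mx mul_scalar_mx !mxE => ->.
  apply: ideal_sum => j _; apply: idealM; rewrite mxE.
  by have [] := cdP j.
(* Modulo [m] the matrix [D] vanishes, so the determinant is congruent to 1 and hence a unit. *)
have [k k1] : exists b, b * \det (1%:M - D) = 1.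
  have : m (1 - \det (1%:M - D)).
    apply/(quot_proj_eq0 (local_ring_proper localR)).
    rewrite rmorphB rmorph1 -det_map_mx map_mxB map_mx1 (_ : map_mx _ D = 0).
      by rewrite subr0 det1 subrr.
    by apply/matrixP => i j; rewrite !mxE; apply/quot_proj_eq0; have [] := cdP i.
  by move=> /local_1B[b]; rewrite subKr; exists b.
move=> x; rewrite Ns; apply: ideal_gen_sub => y /= /(nthP 0)[i si <-].
by rewrite -[_`__]mul1r -k1 -mulrA; apply: idealM; apply: (Ldet (Ordinal si)).
Qed.

End LocalRing.

(** * The residue field and linear dependence over it *)

Section ResidueField.
Variables (R : comNzRingType) (m : ideal R) (localR : local_ring m).

(** A name of its own lets this quotient carry a field structure. *)
Definition residue_field : Type := quotient_ring (local_ring_proper localR).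

HB.instance Definition _ := GRing.ComNzRing.on residue_field.

Definition residue (x : R) : residue_field := quot_proj (local_ring_proper localR) x.

Lemma residue_is_additive : additive residue.
Proof. exact: quot_proj_is_additive. Qed.

Lemma residue_is_multiplicative : multiplicative residue.
Proof. exact: quot_proj_is_multiplicative. Qed.

HB.instance Definition _ :=
  GRing.isAdditive.Build R residue_field residue residue_is_additive.
HB.instance Definition _ :=
  GRing.isMultiplicative.Build R residue_field residue residue_is_multiplicative.

Lemma residue_eq0 x : residue x = 0 <-> m x.
Proof. exact: quot_proj_eq0. Qed.

Lemma residue_neq0 x : residue x != 0 <-> ~ m x.
Proof.
by split=> [/eqP rx /residue_eq0|mx]; [|apply/eqP => /residue_eq0].
Qed.

Lemma residue_surj y : exists x, residue x = y.
Proof. exact: quot_proj_surj. Qed.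

Lemma residue_inv_exists (y : residue_field) :
  exists z, (y != 0 -> z * y = 1) /\ (y = 0 -> z = 0).
Proof.
have [x <-] := residue_surj y.
have [mx|mx] := pselect (m x).
  by exists 0; split; rewrite // (proj2 (residue_eq0 x) mx) eqxx.
have [b bx] := local_inv localR mx; exists (residue b); split=> [_|/residue_eq0//].
by rewrite -rmorphM bx rmorph1.
Qed.

Definition residue_inv (y : residue_field) : residue_field :=
  projT1 (cid (residue_inv_exists y)).

Lemma residue_mulVf y : y != 0 -> residue_inv y * y = 1.
Proof. by rewrite /residue_inv; case: cid => z []. Qed.

Lemma residue_inv0 : residue_inv 0 = 0.
Proof. by rewrite /residue_inv; case: cid => z /= [_ z0]; apply: z0. Qed.

HB.instance Definition _ :=
  GRing.ComNzRing_isField.Build residue_field residue_mulVf residue_inv0.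

(** A matrix over the residue field with more rows than columns has a nonzero left kernel vector;
    its entries are lifted to [R]. *)
Lemma residue_dependence (T U : finType) (C : T -> U -> R) :
  (#|U| < #|T|)%N -> exists u : T -> R,
    (exists i, ~ m (u i)) /\ forall j, m (\sum_i u i * C i j).
Proof.
move=> UT.
pose A : 'M[residue_field]_(#|T|, #|U|) :=
  \matrix_(i, j) residue (C (enum_val i) (enum_val j)).
have [v /sub_kermxP vA v0] : exists2 v : 'rV_#|T|, (v <= kermx A)%MS & v != 0.
  apply/rowV0Pn; rewrite kermx_eq0 -row_leq_rank -ltnNge.
  exact: leq_ltn_trans (rank_leq_col A) UT.
have /choice[w wv] (i : 'I_#|T|) := residue_surj (v 0 i).
exists (w \o enum_rank); split.
  have [i vi] : exists i, v 0 i != 0.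
    apply/existsP; apply: contraNT v0; rewrite negb_exists => /forallP v0.
    by apply/eqP/rowP => i; rewrite mxE; apply/eqP; have := v0 i; rewrite negbK.
  by exists (enum_val i); apply/residue_neq0; rewrite /= enum_valK wv.
move=> j; apply/residue_eq0.
have /matrixP/(_ 0 (enum_rank j)) := vA; rewrite !mxE => vAj.
rewrite rmorph_sum /= -[RHS]vAj (reindex (fun i : 'I_#|T| => enum_val i)) /=.
  by apply: eq_bigr => i _; rewrite mxE rmorphM /= enum_valK wv enum_rankK.
exact/onW_bij/enum_val_bij.
Qed.

End ResidueField.

(** * The grading of the special fiber ring *)

Section SpecialFiber.
Variables (R : comNzRingType) (m I : ideal R) (m1 : ~ m 1).
Local Notation F := (special_fiber I m1).

(* The class of [z X^i] when [z] lies in [I^i], and 0 otherwise. *)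
Definition fiber_elt (i : nat) (z : R) : F :=
  quot_proj (@fiber_kernel_proper R m I m1) (insubd 0 (z *: 'X^i)).

Lemma rees_monomial i z :
  ideal_exp I i z -> rees_poly (insubd (0 : rees I) (z *: 'X^i)) = z *: 'X^i.
Proof.
move=> Iz; apply: (insubdK (0 : rees I)); apply/asboolP => j.
rewrite coefZ coefXn; case: eqP => [->|_]; rewrite ?mulr1 ?mulr0 //.
exact: (ideal0 (ideal_exp I j)).
Qed.

Lemma rees_poly_inj : injective (@rees_poly R I).
Proof. exact: val_inj. Qed.

Lemma rees_poly_sum (T : Type) (r : seq T) (G : T -> rees I) :
  rees_poly (\sum_(i <- r) G i) = \sum_(i <- r) rees_poly (G i).
Proof. exact: (raddf_sum (val : rees I -> {poly R})). Qed.

Lemma fiber_eltD i x y : ideal_exp I i x -> ideal_exp I i y ->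
  fiber_elt i (x + y) = fiber_elt i x + fiber_elt i y.
Proof.
move=> Ix Iy; rewrite /fiber_elt -rmorphD; congr quot_proj.
apply: rees_poly_inj; rewrite [RHS]/= !rees_monomial ?scalerDl //.
exact: idealD.
Qed.

Lemma fiber_eltM i j x y : ideal_exp I i x -> ideal_exp I j y ->
  fiber_elt (i + j) (x * y) = fiber_elt i x * fiber_elt j y.
Proof.
move=> Ix Iy; rewrite /fiber_elt -rmorphM; congr quot_proj.
apply: rees_poly_inj; rewrite [RHS]/= !rees_monomial //; last exact: ideal_expD.
by rewrite -scalerAl -scalerAr scalerA exprD.
Qed.

Definition fiber_scalar : R -> F := fiber_elt 0.

Lemma fiber_scalar_is_additive : additive fiber_scalar.
Proof.
by move=> x y; apply/eqP; rewrite eq_sym subr_eq -fiber_eltD // subrK.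
Qed.

Lemma fiber_scalar_is_multiplicative : multiplicative fiber_scalar.
Proof.
split=> [x y|]; first by rewrite /fiber_scalar -fiber_eltM.
rewrite -[RHS](rmorph1 (quot_proj (@fiber_kernel_proper R m I m1))); congr quot_proj.
by apply: rees_poly_inj; rewrite rees_monomial // scale1r.
Qed.

HB.instance Definition _ :=
  GRing.isAdditive.Build R F fiber_scalar fiber_scalar_is_additive.
HB.instance Definition _ :=
  GRing.isMultiplicative.Build R F fiber_scalar fiber_scalar_is_multiplicative.

Lemma fiber_eltZ i c x :
  ideal_exp I i x -> fiber_elt i (c * x) = fiber_scalar c * fiber_elt i x.
Proof. by move=> Ix; rewrite -fiber_eltM. Qed.

Lemma fiber_elt_eq0 i x : ideal_exp I i x ->
  fiber_elt i x = 0 <-> ideal_mul m (ideal_exp I i) x.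
Proof.
move=> Ix; rewrite /fiber_elt quot_proj_eq0 /= /fiber_kernel_set /=.
rewrite rees_monomial //; split=> [/(_ i)|mx j].
  by rewrite coefZ coefXn eqxx mulr1.
rewrite coefZ coefXn; case: eqP => [->|_]; rewrite ?mulr1 ?mulr0 //.
exact: (ideal0 (ideal_mul m (ideal_exp I j))).
Qed.

Lemma fiber_scalar_eq0 c : fiber_scalar c = 0 <-> m c.
Proof.
rewrite fiber_elt_eq0 //; split; first exact: ideal_mul_subl.
by move=> mc; rewrite -[c]mulr1; apply: mem_ideal_mul.
Qed.

Lemma fiber_elt_sumE (N : nat) (z : nat -> R) (Iz : forall i, ideal_exp I i (z i)) :
  \sum_(i < N) fiber_elt i (z i) =
  quot_proj (@fiber_kernel_proper R m I m1) (\sum_(i < N) insubd 0 (z i *: 'X^i)).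
Proof. by rewrite rmorph_sum. Qed.

(** The filtration by degree: a polynomial of size at most [N.+1] has degree at most [N]. *)
Definition fiber_deg (N : nat) (q : F) : Prop := exists2 p : rees I,
  (size (rees_poly p) <= N.+1)%N & q = quot_proj (@fiber_kernel_proper R m I m1) p.

Lemma fiber_deg_exists q : exists N, fiber_deg N q.
Proof.
have [p <-] := quot_proj_surj q.
by exists (size (rees_poly p)), p.
Qed.

Lemma fiber_degP N q : fiber_deg N q -> exists2 z : nat -> R,
  (forall i, ideal_exp I i (z i)) & q = \sum_(i < N.+1) fiber_elt i (z i).
Proof.
move=> [p sp ->].
have Ip : forall i, ideal_exp I i (rees_poly p)`_i by apply/asboolP; case: p sp.
exists (fun i => (rees_poly p)`_i) => //.
rewrite fiber_elt_sumE //; congr quot_proj; apply: rees_poly_inj.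
rewrite rees_poly_sum (eq_bigr (fun i : 'I_N.+1 => (rees_poly p)`_i *: 'X^i)).
  rewrite -poly_def; apply/polyP => i; rewrite coef_poly.
  by case: ltnP => // Ni; rewrite nth_default // (leq_trans sp).
by move=> i _; rewrite rees_monomial.
Qed.

Lemma fiber_deg_mono M N q : (M <= N)%N -> fiber_deg M q -> fiber_deg N q.
Proof. by move=> MN [p sp ->]; exists p => //; apply: leq_trans sp _. Qed.

Lemma fiber_deg1 N : fiber_deg N 1.
Proof. by exists 1; rewrite ?rmorph1 // size_poly1. Qed.

Lemma fiber_degM M N q q' :
  fiber_deg M q -> fiber_deg N q' -> fiber_deg (M + N) (q * q').
Proof.
move=> [p sp ->] [p' sp' ->]; exists (p * p'); last by rewrite rmorphM.
apply: leq_trans (size_polyMleq _ _) _.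
rewrite -subn1 leq_subLR add1n -addSn -addnS; exact: leq_add.
Qed.

Lemma fiber_degX N q k : fiber_deg N q -> fiber_deg (k * N) (q ^+ k).
Proof.
move=> qN; elim: k => [|k IH]; first exact: fiber_deg1.
by rewrite exprS mulSn; apply: fiber_degM.
Qed.

(** The sum of the graded pieces is direct, because membership in the kernel is tested coefficient
    by coefficient. *)
Lemma fiber_sum_eq0 (N : nat) (z : nat -> R) :
    (forall i, ideal_exp I i (z i)) -> \sum_(i < N) fiber_elt i (z i) = 0 ->
  forall i, (i < N)%N -> fiber_elt i (z i) = 0.
Proof.
move=> Iz; rewrite fiber_elt_sumE // => /quot_proj_eq0 zK i iN.
apply/fiber_elt_eq0 => //; have := zK i.
rewrite rees_poly_sum (eq_bigr (fun j : 'I_N => z j *: 'X^j)) -?poly_def.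
  by rewrite coef_poly iN.
by move=> j _; rewrite rees_monomial.
Qed.

End SpecialFiber.

(** * Prime chains and algebraic independence *)

Section BoxMonomials.
Variable B : nat.

(* Exponent vectors of length [e] with entries below [B], as iterated pairs, so *)
(* that sums over them split by [pair_bigA].                                    *)
Fixpoint expo (e : nat) : finType :=
  if e is e'.+1 then ('I_B * expo e')%type : finType else unit.

Lemma card_expo e : #|expo e| = (B ^ e)%N.
Proof.
elim: e => [|e IH]; first by rewrite card_unit.
by rewrite [expo _]/= card_prod IH card_ord expnS.
Qed.

Variable A : comNzRingType.

Fixpoint expo_mon (e : nat) (x : nat -> A) : expo e -> A :=
  match e return expo e -> A with
  | 0%N => fun=> 1
  | e'.+1 => fun a => x 0%N ^+ a.1 * expo_mon (fun i => x i.+1) a.2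
  end.

Lemma expo_mon_surj e (x : nat -> A) (nu : nat -> nat) :
    (forall q, (nu q < B)%N) ->
  exists a : expo e, expo_mon x a = \prod_(q < e) x q ^+ nu q.
Proof.
move=> nuB; elim: e x nu nuB => [|e IH] x nu nuB; first by exists tt; rewrite big_ord0.
have [a aE] := IH (fun i => x i.+1) (fun q => nu q.+1) (fun q => nuB q.+1).
by exists (Ordinal (nuB 0%N), a); rewrite /= aE big_ord_recl.
Qed.

Lemma prime_ideal_pow (P : ideal A) x y k :
  prime_ideal P -> ~ P x -> P (x ^+ k * y) -> P y.
Proof.
move=> [P1 Ppr] Px; elim: k => [|k IH]; first by rewrite expr0 mul1r.
by rewrite exprS -mulrA => /Ppr[|/IH].
Qed.

(* The lowest power of [x 0] with a nonzero coefficient can be divided out *)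
(* modulo [P 0]; modulo [P 1] only its coefficient survives.               *)
Lemma prime_chain_independent e (P : nat -> ideal A) (x : nat -> A) (c : expo e -> A) :
    (forall i, (i <= e)%N -> prime_ideal (P i)) ->
    (forall i, (i < e)%N -> P i `<=` P i.+1) ->
    (forall i, (i < e)%N -> P i.+1 (x i) /\ ~ P i (x i)) ->
    (forall a, c a = 0 \/ exists b, b * c a = 1) ->
    P 0%N (\sum_a c a * expo_mon x a) ->
  forall a, c a = 0.
Proof.
elim: e P x c => [|e IH] P x c Ppr Pinc xP cU.
  move=> /= Pc [].
  (* Without variables the sum is its one coefficient; lying in a prime ideal, it is not a unit, so
     it is zero. *)
  have Ptt : P 0%N (c tt).
    by move: Pc; rewrite (bigD1 tt) //= big1 ?addr0 ?mulr1 // => -[].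
  case: (cU tt) => // -[b bc]; have [[]] := Ppr 0%N isT.
  by rewrite -bc; apply: idealM.
have -> : \sum_a c a * expo_mon x a = \sum_(i : 'I_B) \sum_(a : expo e)
    c (i, a) * (x 0%N ^+ i * expo_mon (fun i => x i.+1) a).
  by rewrite pair_bigA; apply: eq_bigr => -[].
move=> Pc.
suff cj j : forall (i : 'I_B) a, i = j :> nat -> c (i, a) = 0.
  by move=> [i a]; apply: (cj i).
elim/ltn_ind: j => j IHj i a0 ij.
pose G (k : 'I_B) := \sum_(a : expo e) c (k, a) * expo_mon (fun i => x i.+1) a.
have [xP1 xP0] := xP 0%N isT.
(* Powers below [j] drop out by [IHj]. What remains is [x 0 ^+ j] times the coefficient [G i] plus a
   multiple of [x 0]. *)
have : P 0%N (x 0%N ^+ j *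
    (G i + x 0%N * \sum_(k : 'I_B | (j < k)%N) x 0%N ^+ (k - j.+1) * G k)).
  suff <- : \sum_(k : 'I_B) \sum_a
      c (k, a) * (x 0%N ^+ k * expo_mon (fun i => x i.+1) a) =
    x 0%N ^+ j * (G i + x 0%N * \sum_(k : 'I_B | (j < k)%N) x 0%N ^+ (k - j.+1) * G k)
    by [].
  rewrite (eq_bigr (fun k : 'I_B => x 0%N ^+ k * G k)); last first.
    by move=> k _; rewrite mulr_sumr; apply: eq_bigr => a _; rewrite mulrCA.
  rewrite (bigID (fun k : 'I_B => (j < k)%N)) /=
    [X in _ + X](bigD1 i) ?ij ?ltnn //=.
  rewrite [X in _ + (_ + X)]big1 ?addr0; last first.
    move=> k; rewrite -leqNgt => /andP[kj ki].
    have {}kj : (k < j)%N.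
      by rewrite ltn_neqAle kj andbT -ij; apply: contraNneq ki => /val_inj ->.
    by rewrite /G big1 ?mulr0 // => a _; rewrite (IHj k) ?mul0r.
  rewrite addrC mulrDr; congr (_ + _); rewrite !mulr_sumr; apply: eq_bigr => k jk.
  by rewrite !mulrA -exprSr -exprD subnKC.
move=> /(prime_ideal_pow (Ppr 0%N isT) xP0) /(Pinc 0%N isT) PG.
have {}PG : P 1%N (G i).
  by rewrite -[G i](addrK (x 0%N * \sum_(k : 'I_B | (j < k)%N) x 0%N ^+ (k - j.+1) * G k));
     apply: idealB => //; apply: idealMr.
exact: (IH (fun k => P k.+1) (fun k => x k.+1) (fun a => c (i, a))
  (fun k => Ppr k.+1) (fun k => Pinc k.+1) (fun k => xP k.+1) (fun a => cU (i, a)) PG).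
Qed.

End BoxMonomials.

(** * The dimension of the special fiber ring and the generators of a reduction *)

Section DimensionBound.
Variables (R : comNzRingType) (m : ideal R).
Hypotheses (noethR : noetherian R) (localR : local_ring m).
Variable I : ideal R.
Local Notation m1 := (local_ring_proper localR).
Local Notation F := (special_fiber I m1).
Local Notation elt := (@fiber_elt R m I m1).
Local Notation scal := (@fiber_scalar R m I m1).

(** The span over the residue field, with coefficients lifted to [R]. *)
Definition fiber_span (T : finType) (w : T -> F) : set F :=
  [set q | exists c : T -> R, q = \sum_t scal (c t) * w t].

Section Span.
Variables (T : finType) (w : T -> F).

Lemma fiber_span0 : fiber_span w 0.
Proof. by exists (fun=> 0); rewrite big1 // => t _; rewrite rmorph0 mul0r. Qed.

Lemma fiber_spanD x y : fiber_span w x -> fiber_span w y -> fiber_span w (x + y).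
Proof.
move=> [c ->] [d ->]; exists (fun t => c t + d t).
by rewrite -big_split; apply: eq_bigr => t _; rewrite rmorphD mulrDl.
Qed.

Lemma fiber_spanZ a x : fiber_span w x -> fiber_span w (scal a * x).
Proof.
move=> [c ->]; exists (fun t => a * c t).
by rewrite mulr_sumr; apply: eq_bigr => t _; rewrite rmorphM mulrA.
Qed.

Lemma mem_fiber_span t : fiber_span w (w t).
Proof.
exists (fun t' => (t' == t)%:R); rewrite (bigD1 t) //= eqxx rmorph1 mul1r.
by rewrite big1 ?addr0 // => t' /negPf ->; rewrite rmorph0 mul0r.
Qed.

Lemma fiber_span_sum (S : Type) (r : seq S) (Q : pred S) (G : S -> F) :
  (forall i, Q i -> fiber_span w (G i)) -> fiber_span w (\sum_(i <- r | Q i) G i).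
Proof.
by move=> GS; elim/big_ind: _ => //; [apply: fiber_span0 | apply: fiber_spanD].
Qed.

End Span.

(** Each power of [I] is finitely generated, and generators of the powers up to [r] together form a
    finite family. *)
Lemma low_degree_span (r : nat) : exists (T : finType) (w : T -> F),
  forall i z, (i <= r)%N -> ideal_exp I i z -> fiber_span w (elt i z).
Proof.
have /choice[s sE] (i : nat) := noethR (ideal_exp I i).
pose T := {i : 'I_r.+1 & 'I_(size (s i))}.
pose w (t : T) := elt (tag t) (s (tag t))`_(tagged t).
exists T, w => i z; rewrite -ltnS => ir Iz.
have := Iz; rewrite {1}sE => /ideal_gen_seqP[c zE].
have Is j : (j < size (s i))%N -> ideal_exp I i (s i)`_j.
  by move=> js; rewrite sE; apply: sub_ideal_gen => /=; apply: mem_nth.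
have idS : is_ideal [set y | ideal_exp I i y /\ fiber_span w (elt i y)].
  split=> /=.
  - split; first exact: (ideal0 (ideal_exp I i)).
    rewrite (proj2 (fiber_elt_eq0 _ (ideal0 (ideal_exp I i)))); last exact: ideal0.
    exact: fiber_span0.
  - move=> x y [Ix wx] [Iy wy]; split; first exact: idealD.
    by rewrite fiber_eltD //; apply: fiber_spanD.
  - move=> a x [Ix wx]; split; first exact: idealM.
    by rewrite fiber_eltZ //; apply: fiber_spanZ.
suff : Ideal idS z by case.
rewrite zE; apply: ideal_sum => j _; apply: idealM; split; first exact: Is.
exact: (mem_fiber_span w (Tagged (fun i : 'I_r.+1 => 'I_(size (s i)))
  (j : 'I_(size (s (Ordinal ir)))))).
Qed.

Variables (d : nat) (g : nat -> R).
Local Notation K := (ideal_gen (range (fun i : 'I_d => g i))).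

(** Splitting off factors in [K] brings any element down to degree at most [r], where the finite
    family takes over. The spanning family has [N.+1 ^ d * #|T|] members, a polynomial of degree [d]
    in [N]. *)
Lemma reduction_span : reduction I K -> exists (T : finType) (w : T -> F), forall N,
  fiber_deg N `<=` fiber_span (fun t : expo N.+1 d * T =>
    expo_mon (fun q => elt 1 (g q)) t.1 * w t.2).
Proof.
move=> [KI [r redK]]; have [T [w wP]] := low_degree_span r.
exists T, w => N; set W := fun t : _ * T => _.
pose X (nu : nat -> nat) := \prod_(q < d) elt 1 (g q) ^+ nu q.
have XW nu t : (forall q, (nu q <= N)%N) -> fiber_span W (X nu * w t).
  move=> nuN; have [a aE] := @expo_mon_surj N.+1 F d (fun q => elt 1 (g q)) nu nuN.
  by rewrite /X -aE; apply: (mem_fiber_span W (a, t)).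
have IK := reduction_exp KI redK.
have low i nu rho z : (i <= r)%N -> (i + nu <= N)%N -> (forall q, (rho q <= nu)%N) ->
    ideal_exp I i z -> fiber_span W (X rho * elt i z).
  move=> ir iN rhoN /(wP i z ir)[c ->]; rewrite mulr_sumr.
  apply: fiber_span_sum => t _; rewrite mulrCA; apply: fiber_spanZ; apply: XW => q.
  by apply: leq_trans (rhoN q) _; apply: leq_trans iN; apply: leq_addl.
have gI (q : 'I_d) : ideal_exp I 1 (g q).
  by apply: ideal_exp1; apply: KI; apply: sub_ideal_gen; exists q.
(* [rho] counts how often each generator has been split off. As [i] falls by one [nu] grows by one,
   which keeps all exponents at most [N]. *)
have XI i : forall nu rho z, (i + nu <= N)%N -> (forall q, (rho q <= nu)%N) ->
    ideal_exp I i z -> fiber_span W (X rho * elt i z).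
  elim: i => [|i IH] nu rho z iN rhoN Iz; last first.
    have [ri|ir] := leqP r i; last exact: (low i.+1 nu).
    have idS : is_ideal [set y | ideal_exp I i.+1 y /\ fiber_span W (X rho * elt i.+1 y)].
      split.
      - have I0 := ideal0 (ideal_exp I i.+1); split=> //.
        rewrite (proj2 (fiber_elt_eq0 _ I0)); last exact: ideal0.
        by rewrite mulr0; apply: fiber_span0.
      - move=> x y [Ix wx] [Iy wy]; split; first exact: idealD.
        by rewrite fiber_eltD // mulrDr; apply: fiber_spanD.
      - move=> a x [Ix wx]; split; first exact: idealM.
        by rewrite fiber_eltZ // mulrCA; apply: fiber_spanZ.
    suff : Ideal idS z by case.
    have Kz : ideal_mul K (ideal_exp I i) z by rewrite -IK.
    move: (z) Kz; apply: ideal_mul_sub => x y Kx Iy.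
    have [c ->] := proj1 (ideal_genP _ _) Kx.
    rewrite mulr_suml; apply: ideal_sum => q _; rewrite -mulrA; apply: idealM.
    split; first exact: (@ideal_expD _ I 1 i).
    rewrite (@fiber_eltM R m I m1 1 i) // mulrA.
    have -> : X rho * elt 1 (g q) = X (fun p => rho p + (p == q))%N.
      rewrite /X (bigD1 q) //= [in RHS](bigD1 q) //= eqxx addn1 exprS.
      rewrite mulrC mulrA; congr (_ * _); apply: eq_bigr => p pq.
      by rewrite -(inj_eq val_inj) in pq; rewrite (negPf pq) addn0.
    apply: (IH nu.+1) => //; first by rewrite addnS.
    by move=> p; rewrite -addn1 leq_add ?leq_b1.
  exact: (low 0%N nu).
move=> q /fiber_degP[z Iz ->]; apply: fiber_span_sum => i _.
have := @XI i 0%N (fun=> 0%N) (z i); rewrite addn0 -ltnS ltn_ord.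
rewrite /X big1 ?mul1r => [|p _]; last by rewrite expr0.
exact.
Qed.

Lemma fiber_dim_le : reduction I K ->
  forall e (P : nat -> ideal F), prime_chain e P -> (e <= d)%N.
Proof.
move=> redK e P [Ppr Pinc]; rewrite leqNgt; apply/negP => de.
have [T [w wP]] := reduction_span redK.
have /choice[x xP] (i : nat) : exists x, (i < e)%N -> P i.+1 x /\ ~ P i x.
  have [ie|] := boolP (i < e)%N; last by exists 0.
  have [Pi /existsNP[x /not_implyP[Px Pxn]]] := Pinc i ie.
  by exists x.
have /choice[D xD] (i : nat) := fiber_deg_exists (x i).
pose E := (\sum_(i < d.+1) D i)%N.
have xE i : (i <= d)%N -> fiber_deg E (x i).
  move=> id; apply: fiber_deg_mono (xD i).
  by rewrite /E (bigD1 (Ordinal (id : i < d.+1)%N)) //= leq_addr.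
(* There are [B ^ d.+1] monomials in [x 0, ..., x d] with exponents below [B], of degree at most
   [N]. The span has at most [((d.+1 * E).+1 * B) ^ d * #|T|] generators, and [B] is chosen to make
   this smaller. *)
pose B := ((d.+1 * E).+1 ^ d * #|T|).+1.
pose N := (d.+1 * (B * E))%N.
have monN k (y : nat -> F) (a : expo B k) : (forall i, (i < k)%N -> fiber_deg E (y i)) ->
    fiber_deg (k * (B * E)) (expo_mon y a).
  elim: k y a => [|k IH] y a yE; first exact: fiber_deg1.
  rewrite mulSn; apply: fiber_degM; last by apply: IH => i ik; apply: yE.
  apply: fiber_deg_mono (fiber_degX a.1 (yE 0%N isT)).
  by rewrite leq_mul2r ltnW ?orbT.
have /choice[C CE] (a : expo B d.+1) := wP N _ (monN d.+1 x a xE).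
have [|u [[a0 ua0] uC]] := @residue_dependence R m localR (expo B d.+1) _ C.
  rewrite card_prod !card_expo.
  apply: (@leq_ltn_trans (((d.+1 * E).+1 * B) ^ d * #|T|)).
    have expS a b : (a <= b)%N -> (a ^ d <= b ^ d)%N.
      by case: (d) => // k ab; rewrite leq_exp2r.
    rewrite leq_mul2r expS ?orbT //.
    by rewrite /N [(_.+1 * B)%N]mulSn mulnCA [(B * (_ * _))%N]mulnC -add1n leq_add2r.
  by rewrite expnMn -mulnAC expnSr mulnC ltn_pmul2l // expn_gt0.
(* The dependence has a coefficient outside [m], while the prime chain forces every coefficient to
   vanish in the fiber ring. *)
apply: ua0; apply/(@fiber_scalar_eq0 R m I m1).
apply: (@prime_chain_independent B F d.+1 P x (fun a => scal (u a)) _ _ _ _ _ a0).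
- by move=> i id; apply: Ppr; apply: leq_trans id de.
- by move=> i id; apply: (proj1 (Pinc i _)); apply: leq_trans id de.
- by move=> i id; apply: xP; apply: leq_trans id de.
- move=> a; have [mu|mu] := pselect (m (u a)); first by left; apply/fiber_scalar_eq0.
  have [b bu] := local_inv localR mu; right; exists (scal b).
  by rewrite -rmorphM bu rmorph1.
rewrite (eq_bigr (fun a => \sum_t scal (u a * C a t) *
    (expo_mon (fun q => elt 1 (g q)) t.1 * w t.2))); last first.
  move=> a _; rewrite {1}CE mulr_sumr; apply: eq_bigr => t _.
  by rewrite rmorphM mulrA.
rewrite exchange_big /= big1 ?ideal0 // => [|t _]; first exact: (ideal0 (P 0%N)).
by rewrite -mulr_suml -rmorph_sum /= (proj2 (fiber_scalar_eq0 _ _ _)) ?mul0r.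
Qed.

End DimensionBound.

(** * Nonvanishing of polynomials over an infinite field *)

Section MultivariateEvaluation.

Lemma rmorph_mmap n (R : nzRingType) (S T : comNzRingType) (f : R -> S) (h : 'I_n -> S)
    (th : {rmorphism S -> T}) (p : {mpoly R[n]}) :
  th (mmap f h p) = mmap (th \o f) (th \o h) p.
Proof.
rewrite rmorph_sum; apply: eq_bigr => mu _; rewrite rmorphM rmorph_prod.
by congr (_ * _); apply: eq_bigr => i _; rewrite rmorphXn.
Qed.

Lemma eq_mmap n (R S : nzRingType) (f f' : R -> S) (h h' : 'I_n -> S)
    (p : {mpoly R[n]}) :
  f =1 f' -> h =1 h' -> mmap f h p = mmap f' h' p.
Proof.
move=> ff hh; apply: eq_bigr => mu _; rewrite ff; congr (_ * _).
exact: mmap1_eq.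
Qed.

Lemma meval_map_mpoly n (R S : comNzRingType) (f : {rmorphism R -> S}) (v : 'I_n -> R)
    (p : {mpoly R[n]}) :
  (map_mpoly f p).@[f \o v] = f p.@[v].
Proof.
rewrite [RHS]rmorph_mmap /map_mpoly rmorph_mmap /=.
by apply: eq_mmap => [c|i] /=; rewrite ?mevalC ?mevalXU.
Qed.

(** An exponent vector is determined by its last entry and its restriction to the other variables,
    so at most one term contributes. This carries a nonzero coefficient over to the univariate view
    of [p]. *)
Lemma muni_coef n (R : nzRingType) (p : {mpoly R[n.+1]}) (mu : 'X_{1.. n.+1}) :
  (muni p)`_(mu ord_max)@_[multinom mu (widen_ord (leqnSn n) i) | i < n] = p@_mu.
Proof.
have ext (nu : 'X_{1.. n.+1}) : [multinom nu (widen_ord (leqnSn n) i) | i < n] =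
              [multinom mu (widen_ord (leqnSn n) i) | i < n] ->
    nu ord_max = mu ord_max -> nu = mu.
  move=> /mnmP numu nm; apply/mnmP => i; case: (unliftP ord_max i) => [j ->|->] //.
  have := numu j; rewrite !mnmE; congr (_ = _); congr (_ _);
    by apply: val_inj; rewrite /= /bump leqNgt ltn_ord.
rewrite muniE coef_sum raddf_sum /=.
under eq_bigr => nu _ do rewrite coefZ coefXn.
have [mup|mup] := boolP (mu \in msupp p).
  rewrite (bigD1_seq mu) ?msupp_uniq //= eqxx mulr1 mcoeffZ mcoeffX eqxx mulr1.
  rewrite big1 ?addr0 // => nu numu.
  case: eqP => [e|_]; last by rewrite mulr0 mcoeff0.
  rewrite mulr1 mcoeffZ mcoeffX; case: eqP => [e'|_]; last by rewrite mulr0.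
  by rewrite (ext nu) ?eqxx in numu.
rewrite (memN_msupp_eq0 mup) big_seq big1 // => nu nup.
case: eqP => [e|_]; last by rewrite mulr0 mcoeff0.
rewrite mulr1 mcoeffZ mcoeffX; case: eqP => [e'|_]; last by rewrite mulr0.
by rewrite (ext nu) // in nup; rewrite nup in mup.
Qed.

Lemma meval_muni n (R : comNzRingType) (p : {mpoly R[n.+1]}) (v : 'I_n.+1 -> R) :
  p.@[v] = (map_poly (meval (v \o widen_ord (leqnSn n))) (muni p)).[v ord_max].
Proof.
rewrite muniE mevalE rmorph_sum horner_sum; apply: eq_bigr => mu _.
rewrite -mul_polyC rmorphM /= map_polyC /= map_polyXn hornerCM hornerXn.
rewrite mevalZ mevalX -mulrA; congr (_ * _).
rewrite big_ord_recr /=; congr (_ * _).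
by apply: eq_bigr => i _; rewrite mnmE.
Qed.

Lemma poly_nonroot (k : fieldType) (p : {poly k}) :
  infinite_set [set: k] -> p != 0 -> exists x, p.[x] != 0.
Proof.
move=> kinf p0; have [B _ Bp] := infinite_set_fset (size p) kinf.
have /allPn[x _ px] : ~~ all (root p) (finmap.enum_fset B).
  apply/negP => Broot.
  by have := max_poly_roots p0 Broot (finmap.fset_uniq B); rewrite ltnNge Bp.
by exists x.
Qed.

(** By induction, some coefficient of [p] as a polynomial in the last variable is nonzero at a point
    [v]. Evaluating the coefficients at [v] leaves a nonzero univariate polynomial. *)
Lemma mpoly_nonroot n (k : fieldType) (p : {mpoly k[n]}) :
  infinite_set [set: k] -> p != 0 -> exists v, p.@[v] != 0.
Proof.
move=> kinf; elim: n p => [|n IH] p.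
  have -> : p = (p@_0)%:MP.
    apply/mpolyP => mu; rewrite mcoeffC (_ : mu = 0%MM) ?eqxx ?mulr1 //.
    by apply/mnmP => -[].
  by rewrite mpolyC_eq0 => p0; exists (fun=> 0); rewrite mevalC.
rewrite -msupp_eq0; case E : (msupp p) => [|mu s] // _.
have pmu : p@_mu != 0 by rewrite -mcoeff_msupp E mem_head.
have /IH[v vp] : (muni p)`_(mu ord_max) != 0.
  by apply: contraNneq pmu => p0; rewrite -muni_coef p0 mcoeff0.
have [|x xp] := @poly_nonroot k (map_poly (meval v) (muni p)) kinf.
  apply: contraNneq vp => p0.
  have := congr1 (fun q : {poly k} => q`_(mu ord_max)) p0.
  by rewrite coef_map coef0 /= => ->.
pose w (i : 'I_n.+1) := if unlift ord_max i is Some j then v j else x.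
exists w; rewrite meval_muni.
have -> : w ord_max = x by rewrite /w unlift_none.
rewrite (_ : map_poly _ _ = map_poly (meval v) (muni p)) //.
apply: eq_map_poly => q; apply: meval_eq => i /=; rewrite /w.
rewrite (_ : widen_ord _ _ = lift ord_max i) ?liftK //.
by apply: val_inj; rewrite /= /bump leqNgt ltn_ord.
Qed.

End MultivariateEvaluation.

(** * Prime chains under surjective ring morphisms *)

Section PrimeImage.
Variables (A B : comNzRingType) (f : {rmorphism A -> B}).

Lemma kernel_closed : is_ideal [set x | f x = 0].
Proof.
split=> /=; first exact: rmorph0.
  by move=> x y fx fy; rewrite rmorphD fx fy addr0.
by move=> a x fx; rewrite rmorphM fx mulr0.
Qed.

Definition kernel_ideal : ideal A := Ideal kernel_closed.

Hypothesis f_surj : forall y, exists x, f x = y.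

Lemma image_closed (Q : ideal A) : is_ideal (f @` Q).
Proof.
split; first by exists 0; [apply: ideal0 | apply: rmorph0].
  move=> _ _ [x Qx <-] [y Qy <-]; exists (x + y); last exact: rmorphD.
  exact: idealD.
move=> a _ [x Qx <-]; have [b <-] := f_surj a.
by exists (b * x); [apply: idealM | apply: rmorphM].
Qed.

Definition image_ideal (Q : ideal A) : ideal B := Ideal (image_closed Q).

Lemma image_idealP (Q : ideal A) x :
  kernel_ideal `<=` Q -> image_ideal Q (f x) <-> Q x.
Proof.
move=> kQ; split=> [[y Qy fyx]|Qx]; last by exists x.
rewrite -(subKr y x); apply: idealB => //; apply: kQ => /=.
by rewrite rmorphB fyx subrr.
Qed.

Lemma image_prime (Q : ideal A) :
  kernel_ideal `<=` Q -> prime_ideal Q -> prime_ideal (image_ideal Q).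
Proof.
move=> kQ [Q1 Qpr]; split=> [|x y].
  by rewrite -(rmorph1 f) => /(image_idealP _ kQ).
have [a <-] := f_surj x; have [b <-] := f_surj y.
by rewrite -rmorphM !image_idealP //; apply: Qpr.
Qed.

Lemma image_prime_chain e (Q : nat -> ideal A) :
    (forall i, kernel_ideal `<=` Q i) -> prime_chain e Q ->
  prime_chain e (fun i => image_ideal (Q i)).
Proof.
move=> kQ [Qpr Qinc]; split=> [i ie|i ie]; first by apply: image_prime => //; apply: Qpr.
have [QS QN] := Qinc i ie; split.
  by move=> y; have [x <-] := f_surj y; rewrite !image_idealP //; apply: QS.
move=> SQ; apply: QN => x /(image_idealP _ (kQ _))/SQ.
by rewrite image_idealP.
Qed.

End PrimeImage.

Lemma kernel_prime (A : comNzRingType) (B : idomainType) (f : {rmorphism A -> B}) :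
  prime_ideal (kernel_ideal f).
Proof.
split=> [/= /eqP|x y /= /eqP]; first by rewrite rmorph1 oner_eq0.
by rewrite rmorphM mulf_eq0 => /orP[] /eqP; [left | right].
Qed.

(** * The special fiber ring as a quotient of a polynomial ring *)

Section FiberGenerators.
Variables (R : comNzRingType) (m : ideal R) (localR : local_ring m).
Variable I : ideal R.
Local Notation m1 := (local_ring_proper localR).
Local Notation F := (special_fiber I m1).
Local Notation elt := (@fiber_elt R m I m1).
Local Notation scal := (@fiber_scalar R m I m1).
Variables (s : nat) (h : 'I_s -> R).
Hypothesis hI : generates h I.

Lemma generators_mem i : I (h i).
Proof. by rewrite -hI; apply: sub_ideal_gen; exists i. Qed.

Lemma fiber_elt0 i : elt i 0 = 0.
Proof. by apply/fiber_elt_eq0; apply: ideal0. Qed.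

Lemma fiber_elt_sum (T : Type) (r : seq T) (Q : pred T) i (G : T -> R) :
    (forall t, Q t -> ideal_exp I i (G t)) ->
  elt i (\sum_(t <- r | Q t) G t) = \sum_(t <- r | Q t) elt i (G t).
Proof.
move=> GI; elim: r => [|t r IH]; first by rewrite !big_nil fiber_elt0.
rewrite !big_cons; case: ifP => // Qt.
by rewrite fiber_eltD ?IH //; [apply: GI | apply: ideal_sum].
Qed.

Lemma fiber_elt_pow x k : I x -> elt k (x ^+ k) = elt 1 x ^+ k.
Proof.
move=> Ix; elim: k => [|k IH]; first by rewrite !expr0; apply: (rmorph1 scal).
rewrite !exprS -IH -add1n fiber_eltM //; first exact: ideal_exp1.
exact: ideal_exp_pow.
Qed.

Lemma fiber_elt_prod (T : Type) (r : seq T) (e : T -> nat) (G : T -> R) :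
    (forall t, ideal_exp I (e t) (G t)) ->
  elt (\sum_(t <- r) e t)%N (\prod_(t <- r) G t) = \prod_(t <- r) elt (e t) (G t).
Proof.
move=> GI; elim: r => [|t r IH]; first by rewrite !big_nil; apply: (rmorph1 scal).
by rewrite !big_cons fiber_eltM ?IH //; apply: ideal_exp_prod.
Qed.

Lemma monomial_ideal_exp (mu : 'X_{1.. s}) :
  ideal_exp I (mdeg mu) (\prod_i h i ^+ mu i).
Proof.
rewrite mdegE; apply: ideal_exp_prod => i.
exact/ideal_exp_pow/generators_mem.
Qed.

Definition fiber_pres : {mpoly R[s]} -> F := mmap scal (fun i => elt 1 (h i)).

HB.instance Definition _ := GRing.RMorphism.copy fiber_pres fiber_pres.

(** This turns the vanishing of a form in the fiber ring into a condition on its value at [h]. *)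
Lemma fiber_pres_homog d (f : {mpoly R[s]}) :
  f \is d.-homog -> ideal_exp I d f.@[h] /\ fiber_pres f = elt d f.@[h].
Proof.
move=> /dhomogP fd.
have Id (mu : 'X_{1.. s}) : mu \in msupp f ->
    ideal_exp I d (f@_mu * \prod_i h i ^+ mu i).
  by move=> muf; rewrite -(fd mu muf); apply: idealM; apply: monomial_ideal_exp.
split.
  by rewrite mevalE big_seq; apply: ideal_sum => mu muf; apply: Id.
rewrite mevalE /fiber_pres /mmap.
rewrite big_seq [X in elt d X]big_seq fiber_elt_sum //; apply: eq_bigr => mu muf.
have hI1 i : ideal_exp I (mu i) (h i ^+ mu i) by exact/ideal_exp_pow/generators_mem.
have -> : d = mdeg mu by rewrite -(fd mu muf).
rewrite fiber_eltZ; last exact: monomial_ideal_exp.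
rewrite mdegE fiber_elt_prod //; congr (_ * _); apply: eq_bigr => i _.
exact/esym/fiber_elt_pow/generators_mem.
Qed.

Lemma fiber_pres_surj q : exists f, fiber_pres f = q.
Proof.
have surjD d z : ideal_exp I d z -> exists f, fiber_pres f = elt d z.
  elim: d z => [|d IH] z Iz; first by exists z%:MP; rewrite /fiber_pres mmapC.
  have idS : is_ideal [set y | ideal_exp I d.+1 y /\ exists f, fiber_pres f = elt d.+1 y].
    split.
    - split; first exact: (ideal0 (ideal_exp I d.+1)).
      by exists 0; rewrite rmorph0 fiber_elt0.
    - move=> x y [Ix [f fx]] [Iy [g gy]]; split; first exact: idealD.
      by exists (f + g); rewrite rmorphD /= fiber_eltD // fx gy.
    - move=> a x [Ix [f fx]]; split; first exact: idealM.
      exists (a%:MP * f); rewrite rmorphM /= fiber_eltZ // fx.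
      by rewrite /fiber_pres /= mmapC.
  suff : Ideal idS z by case.
  move: (z) Iz; apply: ideal_mul_sub => x y; rewrite -hI => /ideal_genP[c ->] Iy.
  rewrite mulr_suml; apply: ideal_sum => i _; rewrite -mulrA; apply: idealM.
  have hi := generators_mem i; split; first exact: mem_ideal_mul.
  have [f fy] := IH y Iy; exists ('X_i * f).
  rewrite rmorphM /= fy (@fiber_eltM R m I m1 1 d) //; last exact: ideal_exp1.
  by rewrite /fiber_pres /= mmapX mmap1U.
have [N /fiber_degP[z Iz ->]] := fiber_deg_exists q.
have /choice[f fE] (i : nat) := surjD i (z i) (Iz i).
by exists (\sum_(i < N.+1) f i); rewrite rmorph_sum; apply: eq_bigr.
Qed.

(** Algebraic independence over the residue field of the classes of the [h i] in the fiber ring,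
    phrased with lifts to [R]. Forms suffice because the fiber ring is graded. *)
Definition residually_independent : Prop := forall d (f : {mpoly R[s]}),
  f \is d.-homog -> ideal_mul m (ideal_exp I d) f.@[h] -> forall mu, m f@_mu.

(** The homogeneous components of [f] map to different degrees, so each of them maps to zero and
    independence applies to it. *)
Lemma fiber_pres_kernel :
  residually_independent -> forall f, fiber_pres f = 0 -> forall mu, m f@_mu.
Proof.
move=> indep f; pose N := msize f.
have fE : f = \sum_(d < N) pihomog mdeg d f by apply: pihomog_partitionE.
have hom d := fiber_pres_homog (pihomogP mdeg d f).
rewrite {1}fE rmorph_sum /= (eq_bigr (fun d : 'I_N => elt d (pihomog mdeg d f).@[h])).
  move=> /(fiber_sum_eq0 (fun d => proj1 (hom d))) f0 mu.
  rewrite fE raddf_sum /=; apply: ideal_sum => d _.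
  apply: (indep d) (pihomogP mdeg d f) _ mu.
  by apply/(@fiber_elt_eq0 R m I m1); [apply: (proj1 (hom d)) | apply: f0].
by move=> d _; apply: (proj2 (hom d)).
Qed.

Local Notation k := (residue_field localR).

(** The kernel is the preimage in the polynomial ring over [R] of the prime generated by the first
    [i] variables over [k]. *)
Definition kill_vars (i : nat) : {mpoly R[s]} -> {mpoly k[s]} :=
  mmap (@mpolyC s k \o residue localR) (fun j : 'I_s => if (j < i)%N then 0 else 'X_j).

HB.instance Definition _ i := GRing.RMorphism.copy (kill_vars i) (kill_vars i).

Lemma kill_vars_coef i f : (forall mu, m f@_mu) -> kill_vars i f = 0.
Proof.
move=> mf; rewrite /kill_vars /mmap big1 // => mu _ /=.
by rewrite (proj2 (residue_eq0 localR _)) // mpolyC0 mul0r.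
Qed.

(** Killing one more variable factors through [kill_vars i]. *)
Lemma kill_vars_mono i f : kill_vars i f = 0 -> kill_vars i.+1 f = 0.
Proof.
move=> f0.
pose th := mmap (@mpolyC s k) (fun j : 'I_s => if (j < i.+1)%N then 0 else 'X_j).
have <- : th (kill_vars i f) = kill_vars i.+1 f.
  rewrite /th /kill_vars rmorph_mmap; apply: eq_mmap => [c|j] /=.
    by rewrite mmapC.
  case: ltnP => ij; first by rewrite rmorph0 ltnS ltnW.
  by rewrite mmapX mmap1U.
by rewrite f0; apply: mmap0.
Qed.

(** Independence puts the kernel of the presentation inside every kernel of [kill_vars], so these
    primes descend to the fiber ring. The variable of index [i] separates the primes [i] and
    [i.+1]. *)
Lemma independent_prime_chain :
  residually_independent -> exists P : nat -> ideal F, prime_chain s P.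
Proof.
move=> indep; exists (fun i => image_ideal fiber_pres_surj (kernel_ideal (kill_vars i))).
apply: image_prime_chain.
  by move=> i f /= /(fiber_pres_kernel indep); apply: kill_vars_coef.
split=> [i _|i iS]; first exact: kernel_prime.
split=> [f|]; first exact: kill_vars_mono.
move=> /(_ 'X_(Ordinal iS)) /=; rewrite /kill_vars !mmapX !mmap1U /= ltnn ltnSn.
by move=> /(_ erefl) /eqP; rewrite -msupp_eq0 msuppX.
Qed.

End FiberGenerators.

(** * Congruences degree by degree modulo a subideal *)

Section DegreewiseCongruence.
Variables (R : comNzRingType) (I K : ideal R).

(** For [K] inside [I], the degree [d] piece of the ideal that [K], placed in degree 1, generates in
    the Rees algebra; in degree 0 it is zero. *)
Definition congr_ideal (d : nat) : ideal R :=
  if d is e.+1 then ideal_mul K (ideal_exp I e) else ideal_gen set0.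

Lemma congr_ideal_mul i j x y :
  congr_ideal i x -> ideal_exp I j y -> congr_ideal (i + j) (x * y).
Proof.
case: i => [|i] Lx Iy.
  by apply: idealMr; move: x Lx; apply: ideal_gen_sub.
rewrite addSn mulrC; apply: (ideal_mulP _ Lx) => a b Ka Ib.
by rewrite mulrCA [y * b]mulrC; apply: mem_ideal_mul => //; apply: ideal_expD.
Qed.

(** The factors are replaced one at a time, the others supplying the missing powers of [I]. *)
Lemma congr_ideal_prod (T : Type) (r : seq T) (e : T -> nat) (F G : T -> R) :
    (forall i, ideal_exp I (e i) (F i)) -> (forall i, ideal_exp I (e i) (G i)) ->
    (forall i, congr_ideal (e i) (F i - G i)) ->
  congr_ideal (\sum_(i <- r) e i)%N (\prod_(i <- r) F i - \prod_(i <- r) G i).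
Proof.
move=> FI GI FG; elim: r => [|i r IH].
  by rewrite !big_nil subrr; apply: (ideal0 (congr_ideal 0)).
rewrite !big_cons.
have -> : F i * \prod_(j <- r) F j - G i * \prod_(j <- r) G j =
    (F i - G i) * \prod_(j <- r) F j +
    (\prod_(j <- r) F j - \prod_(j <- r) G j) * G i.
  by rewrite mulrBl mulrBl addrA [_ * G i]mulrC subrK [_ * G i]mulrC.
apply: idealD; first by apply: congr_ideal_mul => //; apply: ideal_exp_prod.
by rewrite addnC; apply: congr_ideal_mul.
Qed.

Lemma congr_ideal_pow x y k :
  I x -> I y -> K (x - y) -> congr_ideal k (x ^+ k - y ^+ k).
Proof.
move=> Ix Iy Kxy; elim: k => [|k IH].
  by rewrite subrr; apply: (ideal0 (congr_ideal 0)).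
have -> : x ^+ k.+1 - y ^+ k.+1 = (x - y) * x ^+ k + (x ^+ k - y ^+ k) * y.
  by rewrite mulrBl mulrBl addrA [_ * y]mulrC subrK -exprS -exprSr.
apply: idealD; first by apply: mem_ideal_mul => //; apply: ideal_exp_pow.
by rewrite -addn1; apply: congr_ideal_mul => //; apply: ideal_exp1.
Qed.

End DegreewiseCongruence.

Lemma meval_homogZ n (R : comNzRingType) d (f : {mpoly R[n]}) (a : R) (v : 'I_n -> R) :
  f \is d.-homog -> f.@[fun i => a * v i] = a ^+ d * f.@[v].
Proof.
move=> /dhomogP fd; rewrite !mevalE mulr_sumr big_seq [RHS]big_seq.
apply: eq_bigr => mu muf; rewrite mulrCA; congr (_ * _).
under eq_bigr do rewrite exprMn.
rewrite big_split /=; congr (_ * _).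
by rewrite prodrXr -mdegE -(fd mu muf).
Qed.

(** * A reduction from an algebraic dependence among generators *)

Section ProperReduction.
Variables (R : comNzRingType) (m : ideal R).
Hypotheses (noethR : noetherian R) (localR : local_ring m).
Variable I : ideal R.

Lemma reduction_mod_max (K : ideal R) r : K `<=` I ->
    ideal_exp I r.+1 `<=`
      ideal_add (ideal_mul K (ideal_exp I r)) (ideal_mul m (ideal_exp I r.+1)) ->
  reduction I K.
Proof.
move=> KI IK; split=> //; exists r; apply/seteqP; split; last exact: ideal_mulS.
have [s sE] := noethR (ideal_exp I r.+1).
exact: (nakayama localR sE).
Qed.

Variables (s : nat) (h : 'I_s -> R).
Hypothesis hI : generates h I.

(** A form nonzero modulo [m] is nonzero at some point over the infinite residue field. Some
    coordinate of a lift is a unit, and homogeneity allows scaling it to 1. *)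
Lemma dependent_nonroot : infinite_set [set: residue_field localR] ->
    ~ residually_independent m I h ->
  exists d (f : {mpoly R[s]}) (b : 'I_s -> R) t,
    [/\ f \is d.+1.-homog, ideal_mul m (ideal_exp I d.+1) f.@[h],
        b t = 1 & ~ m f.@[b]].
Proof.
move=> kinf /existsNP[d /existsNP[f /not_implyP[fd /not_implyP[fh /existsNP[mu fmu]]]]].
have [v fv] : exists v, (map_mpoly (residue localR) f).@[v] != 0.
  apply: mpoly_nonroot => //; apply: contra_notN fmu => /eqP f0.
  by apply/(residue_eq0 localR); rewrite -mcoeff_map_mpoly f0 mcoeff0.
have /choice[c cv] (i : 'I_s) := residue_surj (v i).
have fc : ~ m f.@[c].
  apply/(residue_neq0 localR); rewrite -meval_map_mpoly.
  by rewrite (@meval_eq _ _ _ v) // => i /=.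
(* In degree 0 the form is constant: scaling the argument by 0 multiplies its value by [0 ^+ 0 = 1].
   Then [f.@[c] = f.@[h]] lies in [m], a contradiction. *)
case: d fd fh => [|d] fd fh.
  have fhc := meval_homogZ 0 h fd; have fcc := meval_homogZ 0 c fd.
  case: fc; rewrite -[f.@[c]]mul1r -[1](expr0 (0 : R)) -fcc.
  rewrite (@meval_eq _ _ _ (fun i => 0 * h i)) => [|i]; last by rewrite !mul0r.
  by rewrite fhc mul1r; apply: ideal_mul_subl fh.
have [t ct] : exists t, ~ m (c t).
  apply/existsNP => mc; apply: fc; apply/(residue_eq0 localR).
  have := meval_homogZ 0 c fd; rewrite exprS !mul0r => f0.
  rewrite -[RHS](rmorph0 (residue localR)) -f0 -!meval_map_mpoly.
  by apply: meval_eq => i /=; rewrite mul0r rmorph0; apply/residue_eq0.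
have [e ec] := local_inv localR ct.
exists d, f, (fun i => e * c i), t; split=> //.
rewrite (meval_homogZ e c fd) => /(local_prime localR)[] // me.
apply: (local_ring_proper localR).
by rewrite -(expr1n R d.+1) -ec exprMn; apply: idealMr.
Qed.

Lemma dependent_reduction : infinite_set [set: residue_field localR] ->
    ~ residually_independent m I h ->
  exists (t : 'I_s) (y : 'I_s -> R),
    y t = 0 /\ reduction I (ideal_gen (range y)).
Proof.
move=> kinf /(dependent_nonroot kinf)[d [f [b [t [fd fh bt fb]]]]].
have Ih i : I (h i) by exact: generators_mem.
pose y i := h i - b i * h t; exists t, y; split; first by rewrite /y bt mul1r subrr.
set K := ideal_gen (range y).
have Ky i : K (y i) by apply: sub_ideal_gen; exists i.
have KI : K `<=` I.
  by apply: ideal_gen_sub => _ [i _ <-]; apply: idealB => //; apply: idealM.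
apply: (reduction_mod_max KI (r := d)).
set G := ideal_add _ _.
(* [f.@[h]] lies in [m I^(d+1)] and is congruent to [h t ^+ d.+1 * f.@[b]] modulo [K I^d], with
   [f.@[b]] a unit. *)
have Gt : G (h t ^+ d.+1).
  have fht : congr_ideal I K d.+1 (f.@[h] - h t ^+ d.+1 * f.@[b]).
    rewrite -(meval_homogZ _ _ fd) !mevalE -sumrB big_seq; apply: ideal_sum => mu muf.
    rewrite -mulrBr; apply: idealM.
    have -> : d.+1 = (\sum_i mu i)%N by rewrite -mdegE -(dhomogP _ _ _ fd mu muf).
    apply: congr_ideal_prod => i.
    - exact: ideal_exp_pow.
    - by apply: ideal_exp_pow; apply: idealMr.
    apply: congr_ideal_pow => //; first exact: idealMr.
    by rewrite mulrC; apply: Ky.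
  have [e eb] := local_inv localR fb.
  rewrite -[_ ^+ _]mulr1 -eb mulrCA; apply: idealM.
  rewrite -[X in G X](subKr f.@[h]); apply: idealB; first exact: ideal_addr.
  exact: ideal_addl.
(* Modulo [K I^(j-1)], the power [I^j] is generated by [h t ^+ j] alone. *)
have IL j : ideal_exp I j `<=`
    ideal_add (congr_ideal I K j) (ideal_gen (range (fun _ : 'I_1 => h t ^+ j))).
  elim: j => [|j IH].
    move=> z _; apply: ideal_addr; rewrite -[z]mulr1; apply: idealM.
    by apply: sub_ideal_gen; exists 0.
  apply: ideal_mul_sub => x w; rewrite -{1}hI => /ideal_genP[a xE] Iw.
  have [l [q [Ll /ideal_genP[c qE] wE]]] := IH w Iw; rewrite big_ord1 in qE.
  pose kap := \sum_i a i * y i; pose gam := \sum_i a i * b i.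
  have {}xE : x = kap + gam * h t.
    rewrite xE /kap /gam mulr_suml -big_split; apply: eq_bigr => i _ /=.
    by rewrite /y mulrBr mulrA subrK.
  have -> : x * w = kap * w + gam * (l * h t) + (gam * c 0) * h t ^+ j.+1.
    rewrite {1}xE mulrDl -addrA; congr (_ + _).
    by rewrite wE qE exprS mulrDr -!mulrA [h t * l]mulrC [h t * (c 0 * _)]mulrCA.
  apply: idealD; last first.
    by apply: ideal_addr; apply: idealM; apply: sub_ideal_gen; exists 0.
  apply: ideal_addl; apply: idealD.
    by apply: mem_ideal_mul => //; apply: ideal_sum => i _; apply: idealM.
  apply: idealM; rewrite -addn1; apply: congr_ideal_mul => //; exact: ideal_exp1.
move=> z /IL[l [q [Ll /ideal_genP[c ->] ->]]]; rewrite big_ord1.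
by apply: idealD; [apply: ideal_addl | apply: idealM].
Qed.

End ProperReduction.

(** * Generators of an ideal and of its reductions *)

Section Reductions.
Variables (R : comNzRingType) (m : ideal R).
Hypotheses (noethR : noetherian R) (localR : local_ring m).
Variable I : ideal R.
Local Notation m1 := (local_ring_proper localR).
Variables (s : nat) (h : 'I_s -> R).

(** With more than [n] generators, expressing them in [n] others gives a combination in [m I] with a
    unit coefficient. By Nakayama that generator is redundant. *)
Lemma minimal_generating_set_size n :
  mu_eq I n -> minimal_generating_set h I -> (s <= n)%N.
Proof.
move=> [[g gI] _] [hI hmin]; rewrite leqNgt; apply/negP => ns.
have Ih i : I (h i) by exact: generators_mem.
have /choice[C CE] (i : 'I_s) : exists c : 'I_n -> R, h i = \sum_j c j * g j.
  by apply/ideal_genP; rewrite gI.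
have [|u [[t ut] uC]] := @residue_dependence R m localR _ _ C; first by rewrite !card_ord.
have [e eu] := local_inv localR ut.
suff /seteqP[_ /(_ t Logic.I)] : [set i | i != t] = setT by rewrite /= eqxx.
apply: hmin; set L := ideal_gen _; apply/seteqP; split.
  by apply: ideal_gen_sub => _ [i _ <-].
have [sI sE] := noethR I; apply: (nakayama localR sE).
rewrite -{1}hI; apply: ideal_gen_sub => _ [i _ <-].
have Lh j : j != t -> L (h j) by move=> jt; apply: sub_ideal_gen; exists j.
have [->|it] := eqVneq i t; last by apply: ideal_addl; apply: Lh.
have -> : h t = e * \sum_j u j * h j - \sum_(j | j != t) e * (u j * h j).
  by rewrite [X in e * X](bigD1 t) //= mulrDr mulrA eu mul1r mulr_sumr addrK.
apply: idealB; last first.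
  apply: ideal_addl; apply: ideal_sum => j jt.
  by do 2!apply: idealM; apply: Lh.
apply: ideal_addr; apply: idealM.
have -> : \sum_j u j * h j = \sum_j (\sum_i u i * C i j) * g j.
  under eq_bigr do rewrite CE mulr_sumr.
  rewrite exchange_big /=; apply: eq_bigr => j _; rewrite mulr_suml.
  by apply: eq_bigr => k _; rewrite mulrA.
apply: ideal_sum => j _; apply: mem_ideal_mul => //.
exact: generators_mem.
Qed.

(** The error in [m I] contributes only [m I^(r+1)] to [J I^r], which Nakayama absorbs. *)
Lemma reduction_sub_mod_max (J K : ideal R) :
    reduction I J -> K `<=` J -> J `<=` ideal_add K (ideal_mul m I) ->
  reduction I K.
Proof.
move=> [JI [r rJ]] KJ JK.
apply: (reduction_mod_max noethR localR (r := r)); first by move=> x /KJ/JI.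
rewrite {1}rJ; apply: ideal_mul_sub => a b /JK[k [mu [Kk mmu ->]]] Ib.
rewrite mulrDl; apply: idealD.
  by apply: ideal_addl; apply: mem_ideal_mul.
apply: ideal_addr; rewrite mulrC; apply: (ideal_mulP _ mmu) => p q mp Iq.
by rewrite mulrCA [b * q]mulrC; apply: mem_ideal_mul => //; apply: mem_ideal_mul.
Qed.

Hypothesis hI : generates h I.

(** Here [s = n > l] rules out a prime chain of length [s], so the [h i] are dependent. The
    resulting reduction needs at most [s - 1] generators, too few for [I]. *)
Lemma reduction_self_not_minimal (l n : nat) :
    infinite_set [set: residue_field localR] ->
    analytic_spread_eq I m1 l -> mu_eq I n -> l.+1 = n -> (s <= n)%N ->
  exists2 K, reduction I K & K <> I :> set R.
Proof.
move=> kinf [_ spread] [_ nmin] ln sn.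
have ns : (n <= s)%N by apply: nmin hI.
have [/(independent_prime_chain localR hI)[P /spread]|dep] :=
    pselect (residually_independent m I h).
  by rewrite -ltnS ln ltnNge ns.
have [t [y [yt redy]]] := dependent_reduction noethR hI kinf dep.
exists (ideal_gen (range y)) => // yI.
have s0 : (0 < s)%N by apply: leq_ltn_trans (ltn_ord t).
suff /nmin : generates (fun i : 'I_s.-1 => y (lift t i)) I.
  by move=> /(leq_trans sn); rewrite leqNgt prednK ?leqnn.
rewrite /generates -yI; apply/seteqP; split.
  by apply: ideal_gen_mono => _ [i _ <-]; exists (lift t i).
apply: ideal_gen_sub => _ [i _ <-]; case: (unliftP t i) => [j ->|->].
  by apply: sub_ideal_gen; exists j.
by rewrite yt; apply: ideal0.
Qed.

(* A minimal set of the [h i] generating I modulo J: relations among them *)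
(* modulo J have coefficients in m.                                       *)
Lemma complement_generators (J : ideal R) : J `<=` I ->
  exists (T : {set 'I_s}) (a : 'I_s -> 'I_s -> R),
    (forall i, J (h i - \sum_(t in T) a i t * h t)) /\
    (forall c : 'I_s -> R, J (\sum_(t in T) c t * h t) ->
       forall t, t \in T -> m (c t)).
Proof.
move=> JI.
pose spans (T : {set 'I_s}) := `[< I `<=` ideal_add J (ideal_gen (h @` [set i | i \in T])) >].
have spansT : spans finset.setT.
  apply/asboolP => x; rewrite -hI => Ix; apply: ideal_addr; move: x Ix.
  by apply: ideal_gen_mono => _ [i _ <-]; exists i => //=; rewrite finset.inE.
case: (arg_minnP (fun T : {set 'I_s} => #|T|) spansT) => T /asboolP IT Tmin.
have /choice[a aP] (i : 'I_s) : exists a : 'I_s -> R, J (h i - \sum_(t in T) a t * h t).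
  have [x [z [Jx /ideal_gen_imageP[a ->] ->]]] := IT _ (generators_mem hI i).
  by exists a; rewrite addrK.
exists T, a; split=> // c Jc t tT; apply: contrapT => /(local_inv localR)[e ec].
(* A unit coefficient at [t] expresses [h t] by the others modulo [J], against the minimality of
   [T]. *)
have /Tmin : spans (T :\ t)%SET.
  apply/asboolP; set L := ideal_add _ _.
  have Lh i : i \in T -> L (h i).
    have Lh' j : j \in (T :\ t)%SET -> L (h j).
      by move=> jT; apply: ideal_addr; apply: sub_ideal_gen; exists j.
    have [-> _|it iT] := eqVneq i t; last by apply: Lh'; rewrite finset.in_setD1 it.
    rewrite -[h t]mul1r -ec -mulrA; apply: idealM.
    rewrite (bigD1 t) //= in Jc.
    rewrite -[c t * h t](addrK (\sum_(j in T | j != t) c j * h j)).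
    apply: idealB; first exact: ideal_addl.
    apply: ideal_sum => j /andP[jT jt]; apply: idealM; apply: Lh'.
    by rewrite finset.in_setD1 jt.
  move=> x /IT[y [z [Jy /ideal_gen_imageP[b ->] ->]]].
  apply: idealD; first exact: ideal_addl.
  by apply: ideal_sum => i iT; apply: idealM; apply: Lh.
by rewrite (cardsD1 t T) tT add1n ltnn.
Qed.

End Reductions.

(** * Generators of a minimal reduction *)

Theorem lemma3p2 (R : comNzRingType) (m : ideal R)
    (noethR : noetherian R) (localR : local_ring m)
    (infinite_residue : infinite_quotient (local_ring_proper localR))
    (I : ideal R) (l n : nat)
    (spreadI : analytic_spread_eq I (local_ring_proper localR) l)
    (muI : mu_eq I n)
    (l_eq : l.+1 = n)
    (J : ideal R) (redJ : minimal_reduction I J)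
    (s : nat) (h : 'I_s -> R) (hI : minimal_generating_set h I) :
  exists (t : 'I_s) (a : 'I_s -> R),
    a t = -1 /\ generates (fun i : 'I_s => h i + a i * h t) J.
Proof.
have [rJ Jmin] := redJ; have [JI _] := rJ; have [hgen _] := hI.
have sn := minimal_generating_set_size noethR localR muI hI.
have Ih := generators_mem hgen.
have [T [a [aJ aT]]] := complement_generators localR hgen JI.
pose g i := h i - \sum_(t in T) a i t * h t.
pose K := ideal_gen (g @` [set i | i \in (~: T)%SET]).
have KJ : K `<=` J by apply: ideal_gen_sub => _ [i _ <-]; apply: aJ.
(* Rewriting the [h i] outside [T] through [g i] leaves a combination of the [h t] with [t] in [T].
   It lies in [J], so its coefficients lie in [m]. *)
have JK : J `<=` ideal_add K (ideal_mul m I).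
  move=> x Jx.
  have [r xr] : exists r : 'I_s -> R, x = \sum_i r i * h i.
    by apply/ideal_genP; rewrite hgen; apply: JI.
  pose kap := \sum_(i in (~: T)%SET) r i * g i.
  pose c t := r t + \sum_(i in (~: T)%SET) r i * a i t.
  have Kk : K kap by apply/ideal_gen_imageP; exists r.
  have xE : x = kap + \sum_(t in T) c t * h t.
    rewrite xr (bigID (fun i => i \in T)) /= addrC.
    have -> : \sum_(i | i \notin T) r i * h i =
        kap + \sum_(t in T) (\sum_(i in (~: T)%SET) r i * a i t) * h t.
      under [X in _ + X]eq_bigr do rewrite mulr_suml.
      rewrite exchange_big /kap -big_split /=.
      apply: eq_big => [i|i _]; first by rewrite finset.in_setC.
      rewrite /g mulrBr mulr_sumr.
      by under [X in _ + X]eq_bigr do rewrite -mulrA; rewrite subrK.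
    rewrite -addrA; congr (_ + _); rewrite -big_split; apply: eq_bigr => t _.
    by rewrite /c mulrDl addrC.
  rewrite xE; apply: idealD; first exact: ideal_addl.
  apply: ideal_addr; apply: ideal_sum => t tT; apply: mem_ideal_mul => //.
  apply: aT tT; rewrite -[X in J X](addKr kap) -xE addrC.
  by apply: idealB => //; apply: KJ.
have rK := reduction_sub_mod_max noethR localR rJ KJ JK.
have KE := Jmin K rK KJ.
have lT : (l <= #|~: T|)%N.
  (* The dimension bound takes a family indexed by [nat]; the default 0 is never reached below
     [#|~: T|]. *)
  pose gn q := nth 0 [seq g i | i <- enum (~: T)%SET] q.
  have rgn : range (fun i : 'I_#|~: T| => gn i) = g @` [set i | i \in (~: T)%SET].
    apply/seteqP; split=> [_ [q _ <-]|_ [i iT <-]].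
      exists (enum_val q); first exact: enum_valP.
      by rewrite /gn (nth_map (enum_val q)) -?cardE // -enum_val_nth.
    exists (enum_rank_in iT i) => //.
    by rewrite /gn (nth_map i) -?cardE // -enum_val_nth enum_rankK_in.
  have [[P chP] _] := spreadI.
  by apply: (@fiber_dim_le R m noethR localR I #|~: T| gn) chP; rewrite rgn.
have T1 : (#|T| <= 1)%N.
  have := cardsC T; rewrite card_ord => cT.
  have : (#|T| + #|~: T| <= 1 + #|~: T|)%N.
    by rewrite cT add1n (leq_trans sn) // -l_eq ltnS.
  by rewrite leq_add2r.
(* With [T] empty every [h i] lies in [J], so [J = I] would be minimal among its own reductions. *)
have T0 : T <> finset.set0.
  move=> T0.
  have [K' rK' K'I] := reduction_self_not_minimal noethR hgen infinite_residue spreadI muI l_eq sn.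
  have IJ : I `<=` J.
    rewrite -hgen; apply: ideal_gen_sub => _ [i _ <-].
    by have := aJ i; rewrite T0 big_set0 subr0.
  apply: K'I; have [K'sub _] := rK'.
  rewrite (Jmin K' rK'); first by apply/seteqP; split.
  by move=> x /K'sub/IJ.
have [t TE] : exists t, T = [set t]%SET.
  by apply/cards1P; rewrite eqn_leq T1 card_gt0; apply/eqP.
(* The value -1 makes the generator at [t] zero; the others are the [g i]. *)
exists t, (fun i => if i == t then -1 else - a i t); split; first by rewrite eqxx.
rewrite /generates.
have XE i : h i + (if i == t then -1 else - a i t) * h t = if i == t then 0 else g i.
  case: eqP => [->|_]; first by rewrite mulN1r subrr.
  by rewrite /g TE big_set1 mulNr.
apply/seteqP; split.
  apply: ideal_gen_sub => _ [i _ <-]; rewrite XE.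
  by case: eqP => _; [apply: ideal0 | apply: aJ].
rewrite -KE; apply: ideal_gen_mono => _ [i iT <-]; exists i => //; rewrite XE.
by case: eqP iT => // ->; rewrite /= TE finset.in_setC finset.in_set1 eqxx.
Qed.
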